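(* Given a finite simplicial complex $K$, there exists $n\ge 1$ such that $\mathcal{N}^n(K)$ is isomorphic to the core of $K$.
   Context: All simplicial complexes are finite (simplices are nonempty finite sets of vertices). For a vertex $v$ of a complex $K$, the link $\mathrm{lk}_K(v)$ is the subcomplex of simplices $\tau\in K$ with $v\notin\tau$ and $\tau\cup\{v\}\in K$, and $K\smallsetminus v$ is the full subcomplex of $K$ spanned by the vertices different from $v$. A simplicial cone is a complex $aM$, the join of a (possibly empty) complex $M$ and a vertex $a$ not in $M$; its simplices are $\{a\}$, the simplices $\tau$ of $M$, and the sets $\{a\}\cup\tau$ with $\tau\in M$. A vertex $v$ of $K$ is dominated if $\mathrm{lk}_K(v)$ is a simplicial cone; in that case there is an elementary strong collapse from $K$ to $K\smallsetminus v$. A strong collapse from $K$ to a subcomplex $L$ is a finite (possibly empty) sequence of elementary strong collapses starting in $K$ and ending in $L$. A complex is minimal if it has no dominated vertices. A core of $K$ is a subcomplex $K_0\subseteq K$ which is a minimal complex and such that $K$ strong collapses to $K_0$; every complex has a core and it is unique up to isomorphism, so one speaks of the core of $K$. The nerve $\mathcal{N}(K)$ of a complex $K$ is the complex whose vertices are the maximal simplices of $K$ and whose simplices are the (nonempty) sets of maximal simplices of $K$ with nonempty intersection. Put $\mathcal{N}^1(K)=\mathcal{N}(K)$ and $\mathcal{N}^n(K)=\mathcal{N}(\mathcal{N}^{n-1}(K))$ for $n\ge 2$. *)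

(* Defs.v *)
From HB Require Import structures.
From Stdlib Require Classical_Prop.
From mathcomp Require Import all_boot.

Set Implicit Arguments.
Unset Strict Implicit.
Unset Printing Implicit Defensive.

(* A finite simplicial complex whose vertices are taken from the finite type V.
   Not every element of V has to be a vertex: the vertex set is recovered as
   [vertices K] below, so subcomplexes live over the same V. *)
Definition is_complex (V : finType) (S : {set {set V}}) : bool :=
  (set0 \notin S) &&
  [forall s in S, forall t : {set V},
     (t != set0) && (t \subset s) ==> (t \in S)].

Record complex (V : finType) := Complex {
  simplices :> {set {set V}};
  complexP : is_complex simplices
}.

HB.instance Definition _ (V : finType) := [isSub for @simplices V].

Lemma is_complexP (V : finType) (S : {set {set V}}) :
  reflect (set0 \notin S /\
           forall s t : {set V}, s \in S -> t != set0 -> t \subset s -> t \in S)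
          (is_complex S).
Proof.
apply: (iffP andP) => -[S0 Sdown]; split=> //.
  move=> s t sS t0 ts; move/forall_inP: Sdown => /(_ s sS) /forallP/(_ t).
  by rewrite t0 ts.
apply/forall_inP => s sS; apply/forallP => t; apply/implyP => /andP[t0 ts].
exact: Sdown ts.
Qed.

Section Complexes.

Variable V : finType.
Implicit Types (K L M : complex V) (v a : V) (A s t : {set V}).

Definition vertices K : {set V} := [set v | [set v] \in K].

Definition full_simplices K A : {set {set V}} := [set s in K | s \subset A].

Lemma full_subproof K A : is_complex (full_simplices K A).
Proof.
have /is_complexP[K0 Kdown] := complexP K; apply/is_complexP; split.
  by rewrite inE (negPf K0).
move=> s t; rewrite !inE => /andP[sK sA] t0 ts.
by rewrite (Kdown s) ?(subset_trans ts).
Qed.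

Definition full_subcomplex K A : complex V := Complex (full_subproof K A).

Definition delete K v : complex V := full_subcomplex K (vertices K :\ v).

Definition link_simplices K v : {set {set V}} :=
  [set t in K | (v \notin t) && (v |: t \in K)].

Lemma link_subproof K v : is_complex (link_simplices K v).
Proof.
have /is_complexP[K0 Kdown] := complexP K; apply/is_complexP; split.
  by rewrite inE (negPf K0).
move=> s t; rewrite !inE => /and3P[sK vs vsK] t0 ts.
rewrite (Kdown s t) //= (contra (subsetP ts v) vs) /=.
apply: (Kdown (v |: s)) => //; last exact: setUS.
by apply/set0Pn; exists v; rewrite setU11.
Qed.

Definition link K v : complex V := Complex (link_subproof K v).

(* The simplices of the join aM; M may be empty, so a single point is a cone,
   whereas the empty complex is not. *)
Definition cone_simplices a M : {set {set V}} :=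
  [set a] |: (M :|: [set a |: t | t in simplices M]).

Definition is_cone L : Prop :=
  exists a M, a \notin vertices M /\ simplices L = cone_simplices a M.

Definition dominated K v : Prop := v \in vertices K /\ is_cone (link K v).

Inductive strong_collapse : complex V -> complex V -> Prop :=
| collapse_refl K : strong_collapse K K
| collapse_step K v L :
    dominated K v -> strong_collapse (delete K v) L -> strong_collapse K L.

Definition minimal K : Prop := forall v, ~ dominated K v.

Definition is_core K K0 : Prop :=
  [/\ simplices K0 \subset simplices K, minimal K0 & strong_collapse K K0].

Definition maximal_simplices K : {set {set V}} :=
  [set s in K | [forall t in simplices K, (s \subset t) ==> (s == t)]].

Definition nerve_simplices K : {set {set {set V}}} :=
  [set F : {set {set V}} | [&& F != set0, F \subset maximal_simplices K &
                               \bigcap_(s in F) s != set0]].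

Lemma nerve_subproof K : is_complex (nerve_simplices K).
Proof.
apply/is_complexP; split; first by rewrite inE eqxx.
move=> F G; rewrite !inE => /and3P[_ FK /set0Pn[x /bigcapP xF]] -> GF /=.
rewrite (subset_trans GF) //=; apply/set0Pn; exists x; apply/bigcapP => s sG.
by apply: xF; apply: (subsetP GF).
Qed.

End Complexes.

Definition nerve (V : finType) (K : complex V) : complex {set V} :=
  Complex (nerve_subproof K).

Fixpoint iter_powerset (n : nat) (V : finType) : finType :=
  if n is m.+1 then {set (iter_powerset m V)} : finType else V.

Fixpoint iter_nerve (n : nat) (V : finType) (K : complex V) :
    complex (iter_powerset n V) :=
  if n is m.+1 return complex (iter_powerset n V)
  then nerve (iter_nerve m K) else K.

(* The bijection is between the actual vertex sets: there need not be any
   function V -> W when K is empty. *)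
Definition isomorphic (V W : finType) (K : complex V) (L : complex W) : Prop :=
  exists f : {v : V | v \in vertices K} -> {w : W | w \in vertices L},
    bijective f /\
    forall s : {set {v : V | v \in vertices K}},
      ([set val v | v in s] \in K) = ([set val (f v) | v in s] \in L).

Lemma delete_proper (V : finType) (K : complex V) (v : V) :
  v \in vertices K -> simplices (delete K v) \proper simplices K.
Proof.
rewrite inE => vK; apply/properP; split.
  by apply/subsetP => s; rewrite inE => /andP[].
by exists [set v]; rewrite // inE vK sub1set !inE eqxx.
Qed.

(* A core always exists, so quantifying over the cores of K is not vacuous. *)
Lemma core_exists (V : finType) (K : complex V) : exists K0, is_core K K0.
Proof.
elim: {K}_.+1 {-2}K (ltnSn #|simplices K|) => // n IHn K leKn.
have [[v dv] | noDom] := Classical_Prop.classic (exists v, dominated K v).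
  have prK : simplices (delete K v) \proper simplices K.
    by apply: delete_proper; case: dv.
  have [|K0 [sK0 minK0 colK0]] := IHn (delete K v).
    by apply: leq_trans (proper_card prK) _.
  exists K0; split=> //; last exact: collapse_step dv colK0.
  exact: subset_trans sK0 (proper_sub prK).
exists K; split=> [//|v dv|]; first by apply: noDom; exists v.
exact: collapse_refl.
Qed.

(* Main.v *)
Require Import Defs.
From Stdlib Require Import Relation_Operators.
From Stdlib Require Classical_Prop.
From mathcomp Require Import all_boot.

Set Implicit Arguments.
Unset Strict Implicit.
Unset Printing Implicit Defensive.

(** Call K and L strongly equivalent if there are simplicial maps f : K -> L and
    g : L -> K such that g f and f g are joined to the identities by chains of
    contiguous maps.  On a minimal complex only the identity is contiguous to the
    identity, so strongly equivalent minimal complexes are isomorphic.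
    An elementary strong collapse is a strong equivalence: send the dominated
    vertex to a dominating one.  So is the passage from K to N(N(K)): the vertices
    of N(N(K)) are the maximal elements among the sets star(v) of maximal simplices
    containing v; send such a set to a vertex in its intersection, and v to a
    maximal set containing star(v).  Choosing these representatives embeds the
    vertices of N(N(K)) into those of K, and misses one of them if K is not minimal,
    as a dominated vertex v and a vertex w dominating it satisfy
    star(v) <= star(w).  Hence some iterate is minimal. *)

(** * Maximal simplices, and domination tested on simplices instead of links *)

Section Simplices.

Variable V : finType.
Implicit Types (K : complex V) (v w : V) (s t : {set V}).

Lemma simplex_neq0 K s : s \in simplices K -> s != set0.
Proof.
by move=> sK; apply: contraTneq sK => ->; case/is_complexP: (complexP K).
Qed.

Lemma simplex_sub K s t :
  s \in simplices K -> t != set0 -> t \subset s -> t \in simplices K.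
Proof. by case/is_complexP: (complexP K) => _; apply. Qed.

Lemma simplex_vertex K s v : s \in simplices K -> v \in s -> v \in vertices K.
Proof.
move=> sK vs; rewrite inE; apply: (simplex_sub sK); last by rewrite sub1set.
by apply/set0Pn; exists v; rewrite set11.
Qed.

Lemma maximal_simplex K s : s \in maximal_simplices K -> s \in simplices K.
Proof. by rewrite inE => /andP[]. Qed.

Lemma maximal_simplex_eq K s t :
  s \in maximal_simplices K -> t \in simplices K -> s \subset t -> s = t.
Proof.
by rewrite inE => /andP[_ /forall_inP maxs] tK st; apply/eqP/(implyP (maxs t tK)).
Qed.

Lemma maximal_simplex_exists K s :
  s \in simplices K -> exists2 m, m \in maximal_simplices K & s \subset m.
Proof.
move=> sK; have [m /maxsetP[mK maxm] sm] := @maxset_exists _ (mem (simplices K)) s sK.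
exists m => //; rewrite inE; apply/andP; split; first exact: mK.
apply/forall_inP => t tK; apply/implyP => mt; apply/eqP/esym.
exact: maxm.
Qed.

Lemma dominatedI K v w :
  v \in vertices K -> w != v ->
  (forall s, s \in simplices K -> v \in s -> w |: s \in simplices K) ->
  dominated K v.
Proof.
move=> vK wv dom; split=> //; exists w.
pose A := vertices K :\ w; exists (full_subcomplex (link K v) A).
have inlink t : t \in simplices (link K v) =
    [&& t \in simplices K, v \notin t & v |: t \in simplices K] by rewrite inE.
have wt0 t : w |: t != set0 by apply/set0Pn; exists w; rewrite setU11.
have addw t : v \notin t -> v |: t \in simplices K ->
    w |: t \in simplices (link K v).
  move=> vt /dom; rewrite setU11 => /(_ isT) wvtK.
  rewrite inlink in_setU1 eq_sym (negPf wv) vt setUCA wvtK (simplex_sub wvtK) //.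
  by rewrite setUS ?subsetUr.
split.
  by rewrite !inE sub1set !inE eqxx /= andbF.
apply/setP => t; apply/idP/idP => [tL|].
  move: (tL); rewrite inlink => /and3P[tK vt vtK].
  rewrite /cone_simplices 2!in_setU in_set1.
  have [wt|wt] := boolP (w \in t); last first.
    rewrite [X in _ || (X || _)]inE tL; apply/orP; right; apply/orP; left.
    apply/subsetP => x xt; rewrite in_setD1 (simplex_vertex tK xt) andbT.
    by apply: contraNneq wt => <-.
  have [->|tw] := eqVneq t [set w]; first by [].
  apply/orP; right; apply/orP; right; apply/imsetP; exists (t :\ w).
    have tw0 : t :\ w != set0.
      apply: contraNneq tw => tw0.
      by rewrite -(setD1K wt) tw0 setU0.
    rewrite inE (simplex_sub tL tw0 (subsetDl _ _)) /=.
    apply/subsetP => x; rewrite !in_setD1 => /andP[-> xt].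
    exact: simplex_vertex tK xt.
  by rewrite setD1K.
rewrite /cone_simplices 2!in_setU in_set1 => /or3P[/eqP->||/imsetP[u]].
- have := addw set0; rewrite !setU0 inE => -> //.
  by move: vK; rewrite inE.
- by rewrite inE => /andP[].
rewrite inE inlink => /andP[/and3P[uK vu vuK] _] ->.
exact: addw.
Qed.

(** The apex of the cone serves as [w]: adding it to a simplex of the cone stays in the cone, and it
    differs from [v] because the link avoids [v]. *)
Lemma dominatedE K v :
  dominated K v ->
  exists2 w, w != v &
    forall s, s \in simplices K -> v \in s -> w |: s \in simplices K.
Proof.
case=> vK [w [M [_ linkE]]].
have addw t : t \in simplices (link K v) -> w |: t \in simplices (link K v).
  rewrite linkE /cone_simplices !in_setU !in_set1 => /or3P[/eqP->|tM|/imsetP[u uM ->]].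
  - by rewrite setUid eqxx.
  - by rewrite [w |: t \in _ @: _]imset_f ?orbT.
  - by rewrite setUA setUid [w |: u \in _ @: _]imset_f ?orbT.
have : [set w] \in simplices (link K v) by rewrite linkE setU11.
rewrite inE in_set1 => /and3P[_ vw vwK]; exists w; first by rewrite eq_sym.
(* The case [s = [set v]] is separate because the empty set is not a simplex of the link. *)
move=> s sK vs; have [s1|s1] := eqVneq (s :\ v) set0.
  by rewrite -(setD1K vs) s1 setU0 setUC.
have : s :\ v \in simplices (link K v).
  by rewrite inE (simplex_sub sK s1 (subsetDl _ _)) setD11 setD1K.
by move/addw; rewrite inE => /and3P[_ _]; rewrite setUCA setD1K.
Qed.

End Simplices.

(** * Contiguity and strong equivalence *)

Definition simplicial (V W : finType) (K : complex V) (L : complex W) (f : V -> W) :=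
  forall s : {set V}, s \in simplices K -> f @: s \in simplices L.

Definition contiguous (V W : finType) (K : complex V) (L : complex W)
    (f g : V -> W) :=
  forall s : {set V}, s \in simplices K -> f @: s :|: g @: s \in simplices L.

(** Contiguity is already symmetric, so this closure is an equivalence relation. *)
Definition contiguity_class (V W : finType) (K : complex V) (L : complex W) :=
  clos_refl_trans (V -> W) (contiguous K L).

Definition strongly_equivalent (V W : finType) (K : complex V) (L : complex W) :=
  exists (f : V -> W) (g : W -> V),
    [/\ simplicial K L f, simplicial L K g,
        contiguity_class K K id (g \o f) & contiguity_class L L id (f \o g)].

Section StrongEquivalence.

Variables U V W : finType.

Lemma simplicial_vertex (K : complex V) (L : complex W) f v :
  simplicial K L f -> v \in vertices K -> f v \in vertices L.
Proof. by rewrite !inE => fKL /fKL; rewrite imset_set1. Qed.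

Lemma contiguity_class_compl (J : complex U) (K : complex V) (L : complex W)
    (h : V -> W) f g :
  simplicial K L h -> contiguity_class J K f g ->
  contiguity_class J L (h \o f) (h \o g).
Proof.
move=> hKL; elim=> {f g} [f g fg|f|f g k _ IHfg _ IHgk].
- by apply: rt_step => s /fg/hKL; rewrite imsetU -!imset_comp.
- exact: rt_refl.
- exact: rt_trans IHfg IHgk.
Qed.

Lemma contiguity_class_compr (J : complex U) (K : complex V) (L : complex W)
    (h : U -> V) f g :
  simplicial J K h -> contiguity_class K L f g ->
  contiguity_class J L (f \o h) (g \o h).
Proof.
move=> hJK; elim=> {f g} [f g fg|f|f g k _ IHfg _ IHgk].
- by apply: rt_step => s /hJK/fg; rewrite -!imset_comp.
- exact: rt_refl.
- exact: rt_trans IHfg IHgk.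
Qed.

Lemma strongly_equivalent_refl (K : complex V) : strongly_equivalent K K.
Proof.
exists id, id; split; try exact: rt_refl.
all: by move=> s sK; rewrite imset_id.
Qed.

Lemma strongly_equivalent_sym (K : complex V) (L : complex W) :
  strongly_equivalent K L -> strongly_equivalent L K.
Proof. by case=> f [g []]; exists g, f. Qed.

End StrongEquivalence.

Lemma strongly_equivalent_trans (U V W : finType)
    (J : complex U) (K : complex V) (L : complex W) :
  strongly_equivalent J K -> strongly_equivalent K L -> strongly_equivalent J L.
Proof.
case=> f [g [fJK gKJ gf fg]] [f' [g' [fKL gLK gf' fg']]].
exists (f' \o f), (g \o g'); split.
- by move=> s /fJK/fKL; rewrite -imset_comp.
- by move=> s /gLK/gKJ; rewrite -imset_comp.
(* Insert [id] between [g] and [f], then move this middle factor to [g' \o f']. *)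
- apply: rt_trans gf _.
  exact: contiguity_class_compl gKJ (contiguity_class_compr fJK gf').
- apply: rt_trans fg' _.
  exact: contiguity_class_compl fKL (contiguity_class_compr gLK fg).
Qed.

(** * Strong collapses as strong equivalences *)

Lemma delete_strongly_equivalent (V : finType) (K : complex V) (v : V) :
  dominated K v -> strongly_equivalent K (delete K v).
Proof.
move=> dv; have [w wv dom] := dominatedE dv.
pose r x := if x == v then w else x.
have r_fix (s : {set V}) : v \notin s -> r @: s = s.
  move=> vs; rewrite -[RHS]imset_id; apply: eq_in_imset => x xs; rewrite /r.
  by case: eqP xs => // ->; rewrite (negPf vs).
(* If [v] is in [s], the union lies in [w |: s]; otherwise [r] fixes [s]. This yields both that [r]
   is simplicial and that it is contiguous to [id]. *)
have sr s : s \in simplices K -> s :|: r @: s \in simplices K.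
  move=> sK; have [vs|vs] := boolP (v \in s); last by rewrite r_fix // setUid.
  apply: simplex_sub (dom s sK vs) _ _.
    by have /set0Pn[x xs] := simplex_neq0 sK; apply/set0Pn; exists x; rewrite inE xs.
  rewrite subUset subsetUr; apply/subsetP => _ /imsetP[x xs ->]; rewrite /r.
  by case: ifP => _; rewrite in_setU1 ?eqxx // xs orbT.
have inD s : s \in simplices (delete K v) -> s \in simplices K /\ v \notin s.
  rewrite inE => /andP[sK /subsetP sv]; split=> //.
  by apply/negP => /sv; rewrite in_setD1 eqxx.
exists r, id; split.
- move=> s sK; have rsK : r @: s \in simplices K.
    apply: simplex_sub (sr s sK) _ (subsetUr _ _).
    have /set0Pn[x xs] := simplex_neq0 sK.
    by apply/set0Pn; exists (r x); apply: imset_f.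
  rewrite inE rsK; apply/subsetP => y yrs.
  rewrite in_setD1 (simplex_vertex rsK yrs) andbT.
  by case/imsetP: yrs => x _ ->; rewrite /r; case: (eqVneq x v).
- by move=> s /inD[sK _]; rewrite imset_id.
- by apply: rt_step => s /sr; rewrite imset_id.
- apply: rt_step => s sD; have [_ vs] := inD s sD.
  by rewrite imset_id (r_fix _ vs) setUid.
Qed.

Lemma collapse_strongly_equivalent (V : finType) (K L : complex V) :
  strong_collapse K L -> strongly_equivalent K L.
Proof.
elim=> {K L} [K|K v L dv _]; first exact: strongly_equivalent_refl.
exact/strongly_equivalent_trans/delete_strongly_equivalent.
Qed.

(** * Rigidity of minimal complexes *)

Lemma minimal_contiguity_class (V : finType) (K : complex V) (f : V -> V) :
  minimal K -> contiguity_class K K id f -> {in vertices K, f =1 id}.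
Proof.
(* Induction along the chain needs any starting map that fixes the vertices, not just [id]. *)
move=> minK; suff fix_class g h : contiguity_class K K g h ->
    {in vertices K, g =1 id} -> {in vertices K, h =1 id}.
  by move=> idf; apply: fix_class idf _.
elim=> {f g h} [g h gh gid v vK|//|g h k _ IHgh _ IHhk gid]; last exact/IHhk/IHgh.
(* If [h] moves [v], then [h v] dominates [v]: the simplex [g @: s :|: h @: s] contains [h v |: s]
   whenever [v] is in [s]. *)
apply/eqP/negPn/negP => hv; apply: (minK v); apply: dominatedI hv _ => // s sK vs.
apply: simplex_sub (gh s sK) _ _; first by apply/set0Pn; exists v; rewrite inE vs orbT.
rewrite subUset sub1set inE (imset_f h vs) orbT /=.
apply/subsetP => x xs; rewrite inE -{1}(gid x) ?imset_f //.
exact: simplex_vertex sK xs.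
Qed.

Lemma minimal_isomorphic (V W : finType) (K : complex V) (L : complex W) :
  minimal K -> minimal L -> strongly_equivalent K L -> isomorphic K L.
Proof.
move=> minK minL [f [g [fKL gLK gf fg]]].
have {}gf := minimal_contiguity_class minK gf.
have {}fg := minimal_contiguity_class minL fg.
pose F (x : {v : V | v \in vertices K}) : {w : W | w \in vertices L} :=
  exist _ (f (val x)) (simplicial_vertex fKL (valP x)).
pose G (y : {w : W | w \in vertices L}) : {v : V | v \in vertices K} :=
  exist _ (g (val y)) (simplicial_vertex gLK (valP y)).
exists F; split.
  exists G; first by move=> x; apply: val_inj; apply: gf (valP x).
  by move=> y; apply: val_inj; apply: fg (valP y).
move=> s; rewrite (imset_comp f val s).
(* For the converse, [g] carries the image under [f] back, as [g \o f] fixes the vertices. *)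
apply/idP/idP => [/fKL //|/gLK].
suff -> : g @: (f @: [set val v | v in s]) = [set val v | v in s] by [].
rewrite -!imset_comp; apply: eq_imset => x.
exact: gf (valP x).
Qed.

(** * Comparison of a complex with its double nerve *)

Section DoubleNerve.

Variables (V : finType) (K : complex V).
Implicit Types (v w : V) (m s : {set V}) (F : {set {set V}}).

Definition star v : {set {set V}} := [set m in maximal_simplices K | v \in m].

Lemma star_simplex v : v \in vertices K -> star v \in simplices (nerve K).
Proof.
rewrite inE => vK; have [m mK vm] := maximal_simplex_exists vK.
rewrite inE; apply/and3P; split.
- by apply/set0Pn; exists m; rewrite inE mK -sub1set.
- by apply/subsetP => x; rewrite inE => /andP[].
- by apply/set0Pn; exists v; apply/bigcapP => x; rewrite inE => /andP[].
Qed.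

(** All members of [F] contain [v], so [F] lies in [star v], itself a simplex of the nerve;
    maximality of [F] gives equality. *)
Lemma maximal_nerve_star F v :
  F \in maximal_simplices (nerve K) -> v \in \bigcap_(s in F) s -> F = star v.
Proof.
move=> maxF /bigcapP vF; have := maximal_simplex maxF.
rewrite inE => /and3P[/set0Pn[m mF] /subsetP FK _].
apply: maximal_simplex_eq maxF (star_simplex _) _.
  exact: simplex_vertex (maximal_simplex (FK m mF)) (vF m mF).
by apply/subsetP => x xF; rewrite inE FK ?vF.
Qed.

Lemma vertices_nerve2 : vertices (nerve (nerve K)) = maximal_simplices (nerve K).
Proof.
apply/setP => F; rewrite inE [LHS]inE sub1set big_set1.
apply/and3P/idP => [[]//|maxF]; split=> //; first by apply/set0Pn; exists F; rewrite set11.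
exact: simplex_neq0 (maximal_simplex maxF).
Qed.

(* The base point [x0] is only a default value, needed because F ranges over all
   sets of sets. *)
Definition nerve2_to (x0 : V) F : V :=
  odflt x0 [pick v in \bigcap_(s in F) s].

Definition nerve2_of v : {set {set V}} :=
  odflt set0 [pick F in maximal_simplices (nerve K) | star v \subset F].

Lemma nerve2_toP x0 F :
  F \in maximal_simplices (nerve K) -> nerve2_to x0 F \in \bigcap_(s in F) s.
Proof.
move=> /maximal_simplex; rewrite inE => /and3P[_ _ /set0Pn[v vF]].
by rewrite /nerve2_to; case: pickP => [//|/(_ v)]; rewrite vF.
Qed.

(** This makes [nerve2_to] injective on the vertices of the double nerve. *)
Lemma star_nerve2_to x0 F :
  F \in maximal_simplices (nerve K) -> star (nerve2_to x0 F) = F.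
Proof. by move=> maxF; rewrite -(maximal_nerve_star maxF (nerve2_toP x0 maxF)). Qed.

Lemma nerve2_ofP v :
  v \in vertices K ->
  nerve2_of v \in maximal_simplices (nerve K) /\ star v \subset nerve2_of v.
Proof.
move=> /star_simplex/maximal_simplex_exists[F maxF sF].
by rewrite /nerve2_of; case: pickP => [G /andP[]//|/(_ F)]; rewrite maxF sF.
Qed.

(** A maximal simplex [m] common to all members of [S] contains every chosen point. *)
Lemma nerve2_to_simplicial x0 : simplicial (nerve (nerve K)) K (nerve2_to x0).
Proof.
move=> S; rewrite inE => /and3P[/set0Pn[F FS] /subsetP maxS /set0Pn[m /bigcapP mS]].
have mK : m \in simplices K.
  have := maximal_simplex (maxS F FS); rewrite inE => /and3P[_ /subsetP FK _].
  exact/maximal_simplex/FK/mS.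
apply: simplex_sub mK _ _; first by apply/set0Pn; exists (nerve2_to x0 F); apply: imset_f.
apply/subsetP => _ /imsetP[G GS ->].
by have /bigcapP := nerve2_toP x0 (maxS G GS); apply; apply: mS.
Qed.

(** A maximal [m] containing [s] belongs to [star x], hence to [nerve2_of x], for each [x] in
    [s]. *)
Lemma nerve2_of_simplicial : simplicial K (nerve (nerve K)) nerve2_of.
Proof.
move=> s sK; have [m maxm sm] := maximal_simplex_exists sK.
have /set0Pn[v vs] := simplex_neq0 sK.
rewrite inE; apply/and3P; split.
- by apply/set0Pn; exists (nerve2_of v); apply: imset_f.
- apply/subsetP => _ /imsetP[x xs ->].
  by have [] := nerve2_ofP (simplex_vertex sK xs).
- apply/set0Pn; exists m; apply/bigcapP => _ /imsetP[x xs ->].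
  have [_ /subsetP] := nerve2_ofP (simplex_vertex sK xs); apply.
  by rewrite inE maxm (subsetP sm).
Qed.

Lemma nerve2_strongly_equivalent (x0 : V) : strongly_equivalent K (nerve (nerve K)).
Proof.
exists nerve2_of, (nerve2_to x0); split.
- exact: nerve2_of_simplicial.
- exact: nerve2_to_simplicial.
(* A maximal [m] containing [s] also contains its image under the composite. *)
- apply: rt_step => s sK; have [m maxm sm] := maximal_simplex_exists sK.
  apply: simplex_sub (maximal_simplex maxm) _ _.
    have /set0Pn[v vs] := simplex_neq0 sK.
    by apply/set0Pn; exists v; rewrite inE imset_id vs.
  rewrite imset_id subUset sm; apply/subsetP => _ /imsetP[v vs ->].
  have [maxF /subsetP starF] := nerve2_ofP (simplex_vertex sK vs).
  have /bigcapP := nerve2_toP x0 maxF; apply; apply: starF.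
  by rewrite inE maxm (subsetP sm).
- apply: rt_step => S SN; rewrite imset_id.
  suff -> : (nerve2_of \o nerve2_to x0) @: S = S by rewrite setUid.
  rewrite -[RHS]imset_id; apply: eq_in_imset => F FS /=.
  have maxF : F \in maximal_simplices (nerve K).
    by rewrite -vertices_nerve2; apply: simplex_vertex SN FS.
  have vK : nerve2_to x0 F \in vertices K.
    by apply: simplicial_vertex (nerve2_to_simplicial x0) _; rewrite vertices_nerve2.
  (* [nerve2_of] returns a simplex of the nerve containing the star, which is the maximal [F], hence
     [F] itself. *)
  have [maxG] := nerve2_ofP vK; rewrite (star_nerve2_to x0 maxF).
  by move/(maximal_simplex_eq maxF (maximal_simplex maxG)).
Qed.

Lemma card_vertices_nerve2 v :
  dominated K v -> #|vertices (nerve (nerve K))| < #|vertices K|.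
Proof.
move=> dv; have [vK _] := dv; have [w wv dom] := dominatedE dv.
have toK := nerve2_to_simplicial v.
have inj_to : {in vertices (nerve (nerve K)) &, injective (nerve2_to v)}.
  rewrite vertices_nerve2 => F G maxF maxG eqFG.
  by rewrite -(star_nerve2_to v maxF) eqFG star_nerve2_to.
rewrite -(card_in_imset inj_to) ltnNge; apply/negP => leKN.
(* Without a drop in cardinality, [nerve2_to] hits both [v] and [w], say at [F] and [G]; then
   [F = star v] lies in [G = star w], forcing [F = G] and [v = w]. *)
have imK : nerve2_to v @: vertices (nerve (nerve K)) = vertices K.
  apply/eqP; rewrite eqEcard leKN andbT; apply/subsetP => _ /imsetP[F FN ->].
  exact: simplicial_vertex toK FN.
have wK : w \in vertices K.
  have := dom [set v]; rewrite set11; move: (vK); rewrite inE => vK1 /(_ vK1 isT) wvK.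
  by apply: simplex_vertex wvK _; rewrite setU11.
move: (vK) (wK); rewrite -imK vertices_nerve2 => /imsetP[F maxF vF] /imsetP[G maxG wG].
case/eqP: wv; rewrite wG [RHS]vF; congr nerve2_to; apply/esym.
apply: (maximal_simplex_eq maxF (maximal_simplex maxG)).
rewrite -(star_nerve2_to v maxF) -(star_nerve2_to v maxG) -vF -wG.
apply/subsetP => m; rewrite ![m \in star _]inE => /andP[maxm vm]; rewrite maxm.
have wm := maximal_simplex_eq maxm (dom m (maximal_simplex maxm) vm) (subsetUr _ _).
by rewrite wm setU11.
Qed.

End DoubleNerve.

(** * Iterating the nerve until it is minimal *)

Lemma iter_nerve_minimal (V : finType) (K : complex V) (n : nat) :
  V -> strongly_equivalent K (iter_nerve n K) ->
  exists n', [/\ n <= n', minimal (iter_nerve n' K)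
                 & strongly_equivalent K (iter_nerve n' K)].
Proof.
(* Induction on a bound [k] for the number of vertices, advancing two nerves at a time. *)
move=> x0; move: {2}_.+1 (ltnSn #|vertices (iter_nerve n K)|) => k.
elim: k n => // k IHk n ltnk eqn.
have [[v dv]|nodom] := Classical_Prop.classic (exists v, dominated (iter_nerve n K) v).
  have eqn2 : strongly_equivalent K (iter_nerve n.+2 K).
    exact: strongly_equivalent_trans eqn (nerve2_strongly_equivalent _ v).
  have [|n' [len minn' eqn']] := IHk n.+2 _ eqn2.
    exact: leq_trans (card_vertices_nerve2 dv) ltnk.
  by exists n'; split=> //; apply: leq_trans len; rewrite -addn2 leq_addr.
by exists n; split=> // v dv; apply: nodom; exists v.
Qed.

(** Covers an empty [V], where no base point exists for the maps of a strong equivalence. *)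
Lemma isomorphic_no_vertex (V W : finType) (K : complex V) (L : complex W) :
  vertices K = set0 -> vertices L = set0 -> isomorphic K L.
Proof.
move=> K0 L0.
have noV (x : {v : V | v \in vertices K}) : False by case: x => v; rewrite K0 inE.
have noW (x : {w : W | w \in vertices L}) : False by case: x => w; rewrite L0 inE.
exists (fun x => False_rect _ (noV x)); split.
  by exists (fun y => False_rect _ (noW y)) => [x|y]; [case: (noV x)|case: (noW y)].
move=> s; have -> : s = set0 by apply/setP => x; case: (noV x).
rewrite !imset0; apply/idP/idP => /simplex_neq0; by rewrite eqxx.
Qed.

Theorem proposition3p7 (V : finType) (K : complex V) :
  exists n : nat, 1 <= n /\
    forall K0 : complex V, is_core K K0 -> isomorphic (iter_nerve n K) K0.
Proof.
have [x0 _|noV] := pickP V; last first.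
  exists 1; split=> // K0 _; apply: isomorphic_no_vertex; last first.
    by apply/setP => x; have := noV x.
  apply/setP => m; rewrite inE in_set0; apply/negP => mN.
  have : m \in maximal_simplices K by move: mN; rewrite inE sub1set => /and3P[].
  by move=> /maximal_simplex/simplex_neq0/set0Pn[x]; have := noV x.
(* Starting from the second nerve ensures [1 <= n] even when [K] is already minimal. *)
have [n [n2 minN eqN]] :=
  iter_nerve_minimal x0 (nerve2_strongly_equivalent K x0 :
    strongly_equivalent K (iter_nerve 2 K)).
exists n; split=> [|K0 [_ minK0 /collapse_strongly_equivalent eqK0]]; first exact: ltnW.
apply: minimal_isomorphic minN minK0 _.
exact: strongly_equivalent_trans (strongly_equivalent_sym eqN) eqK0.
Qed.
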